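(* Let $k \geq 2$ be an integer, let $q=p^n$ be a prime power ($p$ prime, $n \ge 1$) with $q \equiv 1 \bmod 2k$, and suppose the generalized Paley graph $\mathcal{P}(q,k)$ is connected. If $\mathbb{F}_p^{\times} \leq (\mathbb{F}_q^{\times})^k$, then $\mathcal{P}(q,k)$ satisfies the Global Matching Condition.
   Context: For an integer $k\ge 2$ and a finite field $\mathbb{F}_q$ of order $q=p^n$ with $q \equiv 1 \bmod 2k$, let $(\mathbb{F}_q^{\times})^k=\{\alpha\in\mathbb{F}_q^\times \mid \alpha=\beta^k \text{ for some } \beta\in\mathbb{F}_q^\times\}$. The generalized Paley graph $\mathcal{P}(q,k)$ is the simple undirected graph with vertex set $\mathbb{F}_q$ in which $x,y$ are adjacent if and only if $x-y\in(\mathbb{F}_q^\times)^k$. (The congruence guarantees $q$ is odd and $-1\in(\mathbb{F}_q^\times)^k$.) Here $\mathbb{F}_p$ is the prime subfield of $\mathbb{F}_q$ and $\le$ is the subgroup relation. For a connected, locally finite, undirected, simple graph $G=(V,E)$ and $v\in V$, let $\Gamma(v)=\{w\in V\mid vw\in E\}$. For an edge $xy\in E$ put $\nabla_{xy}=\Gamma(x)\cap\Gamma(y)$, $N_x=\Gamma(x)\setminus(\nabla_{xy}\cup\{y\})$ and $N_y=\Gamma(y)\setminus(\nabla_{xy}\cup\{x\})$. A perfect matching between $N_x$ and $N_y$ is a bijection $\phi:N_x\to N_y$ such that $z\,\phi(z)\in E$ for all $z\in N_x$. The graph $G$ satisfies the Global Matching Condition if for every edge $xy\in E$ there is a perfect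 matching between $N_x$ and $N_y$. *)

(* Defs.v *)
From HB Require Import structures.
#[local] Set Warnings "-notation-overridden,-ambiguous-paths".
From mathcomp Require Import all_boot all_order all_fingroup all_algebra all_solvable all_field.

Set Implicit Arguments.
Unset Strict Implicit.
Unset Printing Implicit Defensive.

Import GRing.Theory.
Local Open Scope ring_scope.

Section PowersAndPrimeField.
Variable F : finFieldType.

Definition unit_powers (k : nat) : {set {unit F}} :=
  [set (b ^+ k)%g | b in [set: {unit F}]].

Lemma unit_powers_group_set k : group_set (unit_powers k).
Proof.
apply/group_setP; split.
  by apply/imsetP; exists 1%g; rewrite ?inE // expg1n.
move=> _ _ /imsetP[a _ ->] /imsetP[b _ ->]; apply/imsetP.
exists (a * b)%g; rewrite ?inE // expgMn //.
by apply: val_inj; rewrite /= mulrC.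
Qed.
Canonical unit_powers_group k := Group (unit_powers_group_set k).

Definition is_subfield (K : {set F}) : bool :=
  (1 \in K) &&
  [forall x in K, [forall y in K, (x - y \in K) && (x / y \in K)]].

Definition prime_subfield : {set F} :=
  \bigcap_(K : {set F} | is_subfield K) K.

Lemma is_subfieldP (K : {set F}) :
  reflect (divring_closed (mem K)) (is_subfield K).
Proof.
apply: (iffP andP) => [[K1 /forall_inP KP]|[K1 KB KV]]; split=> //.
- by move=> x y Kx Ky; have /forall_inP/(_ y Ky)/andP[] := KP x Kx.
- by move=> x y Kx Ky; have /forall_inP/(_ y Ky)/andP[] := KP x Kx.
by apply/forall_inP=> x Kx; apply/forall_inP=> y Ky; rewrite KB ?KV.
Qed.

Lemma prime_subfield_divring : divring_closed (mem prime_subfield).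
Proof.
split=> [|x y /bigcapP Px /bigcapP Py|x y /bigcapP Px /bigcapP Py];
  apply/bigcapP=> K KF; have /is_subfieldP[K1 KB KV] := KF => //.
- by apply: KB; [apply: Px | apply: Py].
- by apply: KV; [apply: Px | apply: Py].
Qed.

Lemma prime_subfieldE p : p \in [pchar F] ->
  prime_subfield = [set (m%:R : F) | m : 'I_p].
Proof.
move=> pF; have p_pr := pcharf_prime pF; have p0 := prime_gt0 p_pr.
have inN (m : nat) : (m%:R : F) \in [set (i%:R : F) | i : 'I_p].
  apply/imsetP; exists (Ordinal (ltn_pmod m p0)) => //=.
  by rewrite [in LHS](divn_eq m p) natrD natrM (pcharf0 pF) mulr0 add0r.
apply/eqP; rewrite eqEsubset; apply/andP; split.
  apply: bigcap_inf; apply/is_subfieldP; split; first exact: (inN 1).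
  - move=> _ _ /imsetP[i _ ->] /imsetP[j _ ->].
    have ->: i%:R - j%:R = (i + (p - j))%:R :> F.
      by rewrite natrD natrB ?(ltnW (ltn_ord j)) // (pcharf0 pF) sub0r.
    exact: inN.
  move=> _ _ /imsetP[i _ ->] /imsetP[j _ ->].
  have [-> | j0] := eqVneq (j%:R : F) 0; first by rewrite invr0 mulr0; exact: (inN 0).
  have -> : (j%:R : F)^-1 = j%:R ^+ p.-2.
    apply: (mulfI j0); rewrite divff // -exprS prednK ?ltn_predRL ?prime_gt1 //.
    apply: (mulfI j0); rewrite mulr1 -exprS prednK //.
    by rewrite -(pFrobenius_autE pF) pFrobenius_aut_nat.
  by rewrite -natrX -natrM; exact: inN.
apply/subsetP=> _ /imsetP[i _ ->].
have [P1 PB _] := prime_subfield_divring.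
have P0 : 0 \in prime_subfield by rewrite -(subrr 1) PB.
elim: (nat_of_ord i) => // m IH.
by rewrite -addn1 natrD -[1%:R]opprK PB // -sub0r PB.
Qed.

Definition prime_units : {set {unit F}} :=
  [set u | FinRing.uval u \in prime_subfield].

Lemma prime_units_group_set : group_set prime_units.
Proof.
have [P1 PB PV] := prime_subfield_divring.
apply/group_setP; split=> [|u v]; rewrite !inE //= => Pu Pv.
by rewrite -[FinRing.uval v]invrK; apply: (PV) => //; rewrite -div1r; apply: PV.
Qed.
Canonical prime_units_group := Group prime_units_group_set.

(* Adjacency relation of P(q, k), with q = #|F|. *)
Definition paley (k : nat) : rel F :=
  fun x y => [exists u in unit_powers k, x - y == FinRing.uval u].

Lemma paley_irrefl k : irreflexive (paley k).
Proof.
move=> x; apply/exists_inP=> -[u _]; rewrite subrr eq_sym => /eqP u0.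
by have := valP u; rewrite /= u0 unitr0.
Qed.

Lemma paley_sym k : #|F| = 1 %[mod 2 * k] -> symmetric (paley k).
Proof.
move=> hq.
have q1 := finNzRing_gt1 F.
have: (2 * k %| #|F|.-1)%N by rewrite -subn1 -eqn_mod_dvd ?(ltnW q1) //; apply/eqP.
case/dvdnP=> m qE.
have cardU : #|[set: {unit F}]| = (m * (2 * k))%N by rewrite card_finField_unit.
have /cyclicP[g gE] : cyclic [set: {unit F}] by apply: field_unit_group_cyclic.
have og : #[g]%g = (m * (2 * k))%N by rewrite -cardU gE.
have og0 : (0 < m * (2 * k))%N by rewrite -og order_gt0.
have mk0 : (0 < m * k)%N by move: og0; rewrite mulnCA muln_gt0 => /andP[].
pose w := (g ^+ (m * k))%g.
have w2 : (w ^+ 2 = 1)%g by rewrite -expgM -mulnA [(k * 2)%N]mulnC -og expg_order.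
have w1 : (w != 1)%g.
  rewrite -order_dvdn og mulnCA gtnNdvd //.
  by rewrite mul2n -addnn -[X in (X < _)%N]addn0 ltn_add2l.
have wN : FinRing.uval w = -1.
  have /eqP : FinRing.uval w ^+ 2 = 1 by rewrite -FinRing.val_unitX w2.
  rewrite sqrf_eq1 => /orP[] /eqP // we; case/eqP: w1; exact: val_inj.
have imp x y : paley k x y -> paley k y x.
  case/exists_inP=> u Pu /eqP xy; apply/exists_inP; exists (w * u)%g.
    by rewrite groupM //; apply/imsetP; exists (g ^+ m)%g; rewrite ?inE // -expgM.
  by rewrite /= -/w wN mulN1r -xy opprB.
by move=> x y; apply/idP/idP; apply: imp.
Qed.

End PowersAndPrimeField.

Section GlobalMatching.
Variables (V : finType) (e : rel V).

Definition connected_graph : Prop := forall x y : V, connect e x y.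

Definition nbhd (v : V) : {set V} := [set w | e v w].

Definition common_nbhd (x y : V) : {set V} := nbhd x :&: nbhd y.

Definition private_nbhd (x y : V) : {set V} :=
  nbhd x :\: (common_nbhd x y :|: [set y]).

(* Only the values of phi on A matter: phi restricts to a bijection A -> B. *)
Definition perfect_matching (A B : {set V}) (phi : V -> V) : Prop :=
  [/\ {in A &, injective phi}, phi @: A = B & {in A, forall z, e z (phi z)}].

(* common_nbhd is symmetric, so N_y is private_nbhd y x. *)
Definition global_matching_condition : Prop :=
  forall x y : V, e x y ->
    exists phi : V -> V,
      perfect_matching (private_nbhd x y) (private_nbhd y x) phi.

End GlobalMatching.

(* Main.v *)
Require Import Defs.
From mathcomp Require Import all_boot all_order all_fingroup all_algebra all_solvable all_field.
From mathcomp Require Import ring.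

(** Let [xy] be an edge and [d = y - x].  Since the k-th powers contain
    [F_p^*], two distinct points of a line [z + F_p d] are adjacent.  Along such a
    cyclic line, a point of [N_x] starts a maximal run of neighbours of [x]:
    [z] is a neighbour of [x] while [z - d] is not, because adjacency of [z] to
    [y] amounts to adjacency of [z - d] to [x].  Likewise a point of [N_y] is the
    first point after such a run.  Sending the start of each run to the
    point just after its end is the required matching. *)

Set Implicit Arguments.
Unset Strict Implicit.
Unset Printing Implicit Defensive.

Import GRing.Theory.
Local Open Scope ring_scope.

Section PaleyMatching.
Variables (F : finFieldType) (k p : nat).
Hypothesis pcharF : p \in [pchar F].
Hypothesis sub_powers : prime_units_group F \subset unit_powers_group F k.

Let p_pr : prime p := pcharf_prime pcharF.
Let p_gt0 : (0 < p)%N := prime_gt0 p_pr.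

Lemma paley_shift (a b a' b' : F) : a - b = a' - b' -> paley k a b = paley k a' b'.
Proof. by rewrite /paley => ->. Qed.

Lemma paley_mulrn m (a b c d : F) : ~~ (p %| m)%N -> a - b = (c - d) *+ m ->
  paley k c d -> paley k a b.
Proof.
move=> pm ab /exists_inP[u Pu /eqP cd]; apply/exists_inP.
have m_unit : (m%:R : F) \is a GRing.unit by rewrite unitfE -(dvdn_pcharf pcharF).
pose v : {unit F} := FinRing.unit F m_unit.
have Pv : v \in unit_powers F k.
  apply: (subsetP sub_powers); rewrite inE (prime_subfieldE pcharF).
  apply/imsetP; exists (Ordinal (ltn_pmod m p_gt0)) => //=.
  by rewrite [in LHS](divn_eq m p) natrD natrM (pcharf0 pcharF) mulr0 add0r.
exists (v * u)%g; first exact: (@groupM _ (unit_powers_group F k)).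
by rewrite ab cd /= mulr_natl.
Qed.

Lemma prime_ndvd_pred : ~~ (p %| p.-1)%N.
Proof. by rewrite gtnNdvd ?ltn_predL // -ltnS prednK // prime_gt1. Qed.

Lemma paley_symmetric : symmetric (@paley F k).
Proof.
have imp (a b : F) : paley k a b -> paley k b a.
  (* In characteristic [p], negation is multiplication by [p.-1]. *)
  apply: (paley_mulrn prime_ndvd_pred).
  apply: (addIr (a - b)); rewrite -mulrSr prednK // -mulr_natr (pcharf0 pcharF).
  by rewrite mulr0 addrC subrKA subrr.
by move=> a b; apply/idP/idP; apply: imp.
Qed.

(** Translation by [y - x] carries [nbhd x] onto [nbhd y], and each side loses the same common
    neighbours and one endpoint. *)
Lemma card_private_nbhd (x y : F) : paley k x y ->
  #|private_nbhd (@paley F k) x y| = #|private_nbhd (@paley F k) y x|.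
Proof.
have half (a b : F) : paley k a b ->
    #|private_nbhd (@paley F k) a b| =
      (#|nbhd (@paley F k) a| - #|common_nbhd (@paley F k) a b|.+1)%N.
  move=> ab; rewrite cardsDS; last first.
    by rewrite subUset subsetIl sub1set inE.
  by rewrite setUC cardsU1 !inE paley_irrefl andbF.
move=> xy; rewrite !half //; last by rewrite paley_symmetric.
congr (_ - _.+1)%N; last by rewrite /common_nbhd setIC.
rewrite -(card_imset _ (addIr (y - x))); apply: eq_card => w.
apply/imsetP/idP => [[z xz ->]|yw].
  by move: xz; rewrite !inE => xz; rewrite (@paley_shift _ _ x z) //; ring.
exists (w - (y - x)); last by rewrite subrK.
by move: yw; rewrite !inE => yw; rewrite (@paley_shift _ _ y w) //; ring.
Qed.

Lemma private_nbhdE (x y z : F) :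
  (z \in private_nbhd (@paley F k) x y) = [&& z != y, paley k x z & ~~ paley k y z].
Proof. by rewrite !inE; case: paley; case: paley; case: eqP. Qed.

Section Run.
Variables x y : F.
Hypothesis xy : paley k x y.
Local Notation d := (y - x).
Local Notation Nx := (private_nbhd (@paley F k) x y).
Local Notation Ny := (private_nbhd (@paley F k) y x).

(** If the whole line consists of neighbours of [x], [find] returns the default [p]; [run_exitP]
    excludes this on [Nx]. *)
Definition run_length (z : F) : nat :=
  find (fun j => ~~ paley k x (z + d *+ j)) (iota 0 p).

Definition run_exit (z : F) : F := z + d *+ run_length z.

Lemma paley_run (z : F) j : (j < run_length z)%N -> paley k x (z + d *+ j).
Proof.
move=> lt_j; have lt_p : (j < p)%N.
  by apply: leq_trans lt_j _; rewrite -[leqRHS](size_iota 0) find_size.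
by have := before_find 0%N lt_j; rewrite nth_iota // add0n => /negbFE.
Qed.

(* Because [d] has additive order [p], the point [z - d] preceding [z] is [z + (p-1) d]. *)
Lemma run_exitP (z : F) : z \in Nx ->
  (0 < run_length z < p)%N /\ ~~ paley k x (run_exit z).
Proof.
rewrite private_nbhdE => /and3P[_ xz yz].
have dp : d *+ p = 0 by rewrite -mulr_natr (pcharf0 pcharF) mulr0.
have hasP : has (fun j => ~~ paley k x (z + d *+ j)) (iota 0 p).
  apply/hasP; exists p.-1; first by rewrite mem_iota /= add0n prednK.
  rewrite (@paley_shift _ _ y z) //.
  have -> : d *+ p.-1 = - d.
    by apply: (addIr d); rewrite -mulrSr prednK // dp addNr.
  by ring.
have lt_p : (run_length z < p)%N by rewrite -[ltnRHS](size_iota 0) -has_find.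
have exitP : ~~ paley k x (run_exit z).
  by have := nth_find 0%N hasP; rewrite nth_iota.
split=> //; rewrite lt_p andbT lt0n; apply: contraNneq exitP => r0.
by rewrite /run_exit r0 mulr0n addr0.
Qed.

Lemma run_exit_adj (z : F) : z \in Nx -> paley k z (run_exit z).
Proof.
case/run_exitP=> /andP[r0 rp] _.
(* A run length strictly between 0 and [p] is not divisible by [p]. *)
apply: (@paley_mulrn (run_length z) _ _ x y) => //; first by rewrite gtnNdvd.
by rewrite /run_exit opprD addNKr -mulNrn opprB.
Qed.

Lemma run_exit_private (z : F) : z \in Nx -> run_exit z \in Ny.
Proof.
move=> Nz; have [/andP[r0 rp] exitP] := run_exitP Nz.
move: (Nz); rewrite private_nbhdE => /and3P[zy xz yz].
rewrite private_nbhdE exitP andbT; apply/andP; split; last first.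
  (* Shifting back by [d] turns adjacency to [y] into adjacency of the last point of the run to
     [x]. *)
  rewrite (@paley_shift _ _ x (z + d *+ (run_length z).-1)).
    by apply: paley_run; rewrite prednK.
  by rewrite /run_exit -[in LHS](prednK r0) mulrSr; ring.
(* If the exit were [x], then [y - z] would be a multiple of [d], so [z] would equal [y] or be
   adjacent to it. *)
apply: contraNneq yz => zx.
have yzE : y - z = d *+ (run_length z).+1.
  by rewrite mulrSr -[X in _ + (_ - X)]zx /run_exit; ring.
have [pr | npr] := boolP (p %| (run_length z).+1)%N.
  move: zy; rewrite eq_sym -subr_eq0 yzE -mulr_natr.
  by move: pr; rewrite (dvdn_pcharf pcharF) => /eqP->; rewrite mulr0 eqxx.
by apply: (paley_mulrn npr yzE); rewrite paley_symmetric.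
Qed.

Lemma run_exit_inj : {in Nx &, injective run_exit}.
Proof.
have not_lt (z z' : F) : z \in Nx -> run_exit z = run_exit z' ->
    ~~ (run_length z < run_length z')%N.
  rewrite private_nbhdE => /and3P[_ _ yz] zz'; apply/negP => lt_r.
  case/negP: yz.
  set m := (run_length z' - run_length z)%N.
  have m_gt0 : (0 < m)%N by rewrite subn_gt0.
  (* With a common exit, the shorter run starts inside the longer one, so [z - d] is a neighbour of
     [x] and [z] one of [y]. *)
  have zE : z = z' + d *+ m.
    apply: (addIr (d *+ run_length z)).
    by rewrite -addrA -mulrnDr subnK ?(ltnW lt_r).
  rewrite (@paley_shift _ _ x (z' + d *+ m.-1)).
    by apply: paley_run; rewrite prednK //; exact: leq_subr.
  by rewrite zE -[in LHS](prednK m_gt0) mulrSr; ring.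
move=> z z' Nz Nz' zz'.
have rE : run_length z = run_length z'.
  by apply/eqP; rewrite eqn_leq leqNgt not_lt //= leqNgt not_lt.
by move: zz'; rewrite /run_exit rE => /addIr.
Qed.

Lemma run_exit_matching : perfect_matching (@paley F k) Nx Ny run_exit.
Proof.
split; [exact: run_exit_inj | | exact: run_exit_adj].
(* Surjectivity follows from injectivity and equal cardinalities. *)
apply/eqP; rewrite eqEcard (card_in_imset run_exit_inj).
rewrite (card_private_nbhd xy) leqnn andbT; apply/subsetP=> _ /imsetP[z Nz ->].
exact: run_exit_private.
Qed.

End Run.

End PaleyMatching.

Local Close Scope ring_scope.

Theorem theorem1p9 (k p n : nat) (F : finFieldType)
    (hk : 2 <= k) (hp : prime p) (hn : 1 <= n)
    (hF : #|F| = p ^ n)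
    (hq : p ^ n = 1 %[mod 2 * k])
    (hconn : connected_graph (@paley F k))
    (hsub : prime_units_group F \subset unit_powers_group F k) :
  global_matching_condition (@paley F k).
Proof.
move=> x y xy; exists (run_exit k p x y).
have pcharF := card_finPcharP hF hp.
exact: (run_exit_matching pcharF hsub xy).
Qed.
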